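(* Let $\Lambda\in\mathcal H$ be an element of integral type and $g\in\mathcal H$ a group-like element. Then $\mathcal A_\Lambda$ admits a faithful $g$-cointegral if and only if ${}_\Lambda\mathcal V=S(\mathcal A_\Lambda)g$. In particular, if $\mathcal A_\Lambda$ admits a faithful non-zero $g$-cointegral, then (1) $(1\otimes\Lambda)\Delta(\Lambda)=S(\Lambda)g\otimes\Lambda$; (2) $L^{\mathcal A_\Lambda}_\varepsilon=R^{\mathcal A_\Lambda}_\varepsilon$ if and only if $\Lambda=S(\Lambda)g$.
   Context: $k$ is a field; $\mathcal H$ is a Hopf algebra over $k$ with comultiplication $\Delta$, counit $\varepsilon$, invertible antipode $S$, dual $\mathcal H'$. A group-like element is a non-zero $g$ with $\Delta(g)=g\otimes g$. For $\Lambda\in\mathcal H$, ${}_\Lambda\mathcal V=\{(\mathrm{id}\otimes\nu)\Delta(\Lambda):\nu\in\mathcal H'\}$. A non-zero $\Lambda$ is of integral type if $\Delta(\Lambda)(1\otimes\Lambda)=\Lambda\otimes\Lambda$, and $\mathcal A_\Lambda=\{a\in\mathcal H:\Delta(a)(1\otimes\Lambda)=b\otimes\Lambda\text{ for some }b\in\mathcal H\}$ (a finite-dimensional left coideal subalgebra). For a left coideal subalgebra $\mathcal A$, a $g$-cointegral on $\mathcal A$ is $\phi\in\mathcal A'$ with $(\mathrm{id}\otimes\phi)(\Delta(a))=\phi(a)g$ for all $a\in\mathcal A$; it is faithful if $\phi(ab)=0$ for all $b\in\mathcal A$ implies $a=0$. $L^{\mathcal A}_\varepsilon=\{x\in\mathcal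 A: ax=\varepsilon(a)x\ \forall a\in\mathcal A\}$, $R^{\mathcal A}_\varepsilon=\{x\in\mathcal A: xa=\varepsilon(a)x\ \forall a\in\mathcal A\}$. *)

(* Defs.v *)
(* Hopf algebras over a field, with tensors H⊗H modelled by
   finite formal sums (seq (H * H)) up to the universal property of the
   tensor product (agreement under every bilinear map into every k-vector
   space). *)
From HB Require Import structures.
From mathcomp Require Import all_boot all_order all_algebra.
Set Implicit Arguments. Unset Strict Implicit. Unset Printing Implicit Defensive.
Import GRing.Theory.
Local Open Scope ring_scope.

Section Hopf.
Variables (k : fieldType) (H : algType k).

Definition hlin (f : H -> H) := forall (c : k) (x y : H), f (c *: x + y) = c *: f x + f y.
Definition slin (f : H -> k) := forall (c : k) (x y : H), f (c *: x + y) = c * f x + f y.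

Definition bilin (V : lmodType k) (f : H -> H -> V) :=
  (forall (b : H) (c : k) (x y : H), f (c *: x + y) b = c *: f x b + f y b) /\
  (forall (a : H) (c : k) (x y : H), f a (c *: x + y) = c *: f a x + f a y).

Definition trilin (V : lmodType k) (f : H -> H -> H -> V) :=
  (forall (b d : H) (c : k) (x y : H), f (c *: x + y) b d = c *: f x b d + f y b d) /\
  (forall (a d : H) (c : k) (x y : H), f a (c *: x + y) d = c *: f a x d + f a y d) /\
  (forall (a b : H) (c : k) (x y : H), f a b (c *: x + y) = c *: f a b x + f a b y).

Definition tsum (V : lmodType k) (f : H -> H -> V) (t : seq (H * H)) : V :=
  \sum_(p <- t) f p.1 p.2.

Definition teq (t u : seq (H * H)) : Prop :=
  forall (V : lmodType k) (f : H -> H -> V), bilin f -> tsum f t = tsum f u.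

Definition tscale (c : k) (t : seq (H * H)) : seq (H * H) :=
  [seq (c *: p.1, p.2) | p <- t].
Definition tmul (t u : seq (H * H)) : seq (H * H) :=
  [seq (p.1 * q.1, p.2 * q.2) | p <- t, q <- u].

(* Hopf algebra axioms; Delta x is a representative of Δ(x) ∈ H ⊗ H *)
Record is_hopf (Delta : H -> seq (H * H)) (eps : H -> k) (S : H -> H) : Prop := {
  Delta_lin : forall (c : k) (x y : H), teq (Delta (c *: x + y)) (tscale c (Delta x) ++ Delta y);
  Delta_mul : forall x y : H, teq (Delta (x * y)) (tmul (Delta x) (Delta y));
  Delta_one : teq (Delta 1) [:: (1, 1)];
  Delta_coassoc : forall (V : lmodType k) (f : H -> H -> H -> V), trilin f ->
    forall x : H,
      \sum_(p <- Delta x) \sum_(q <- Delta p.1) f q.1 q.2 p.2 =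
      \sum_(p <- Delta x) \sum_(q <- Delta p.2) f p.1 q.1 q.2;
  eps_lin : slin eps;
  eps_mul : forall x y : H, eps (x * y) = eps x * eps y;
  eps_one : eps 1 = 1;
  counit_l : forall x : H, \sum_(p <- Delta x) eps p.1 *: p.2 = x;
  counit_r : forall x : H, \sum_(p <- Delta x) eps p.2 *: p.1 = x;
  S_lin : hlin S;
  antipode_l : forall x : H, \sum_(p <- Delta x) S p.1 * p.2 = (eps x)%:A;
  antipode_r : forall x : H, \sum_(p <- Delta x) p.1 * S p.2 = (eps x)%:A;
  S_bij : bijective S
}.

Variables (Delta : H -> seq (H * H)) (eps : H -> k).

Definition grouplike (g : H) := g <> 0 /\ teq (Delta g) [:: (g, g)].

Definition integral_type (Lam : H) :=
  Lam <> 0 /\ teq [seq (p.1, p.2 * Lam) | p <- Delta Lam] [:: (Lam, Lam)].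

Definition A_ (Lam : H) (a : H) : Prop :=
  exists b : H, teq [seq (p.1, p.2 * Lam) | p <- Delta a] [:: (b, Lam)].

Definition V_ (Lam : H) (x : H) : Prop :=
  exists nu : H -> k, slin nu /\ x = \sum_(p <- Delta Lam) nu p.2 *: p.1.

(* φ is a linear functional on the subspace A (values outside A irrelevant) *)
Definition lin_on (A : H -> Prop) (phi : H -> k) :=
  forall (c : k) (x y : H), A x -> A y -> phi (c *: x + y) = c * phi x + phi y.

(* g-cointegral on a left coideal subalgebra A: (id ⊗ φ)Δ(a) = φ(a) g, where
   (id ⊗ φ) is applied to any representative of Δ(a) in H ⊗ A *)
Definition cointegral (A : H -> Prop) (g : H) (phi : H -> k) :=
  lin_on A phi /\
  forall a : H, A a -> forall t : seq (H * H), teq t (Delta a) ->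
    (forall p, p \in t -> A p.2) ->
    \sum_(p <- t) phi p.2 *: p.1 = phi a *: g.

Definition faithful_on (A : H -> Prop) (phi : H -> k) :=
  forall a : H, A a -> (forall b : H, A b -> phi (a * b) = 0) -> a = 0.

Definition nonzero_on (A : H -> Prop) (phi : H -> k) := exists a : H, A a /\ phi a <> 0.

Definition Leps (A : H -> Prop) (x : H) := A x /\ forall a : H, A a -> a * x = eps a *: x.
Definition Reps (A : H -> Prop) (x : H) := A x /\ forall a : H, A a -> x * a = eps a *: x.

End Hopf.

(* Main.v *)
Require Import Defs.
From HB Require Import structures.
From mathcomp Require Import all_boot all_order all_algebra.
From mathcomp Require Import boolp.
From mathcomp Require classical_sets.
Import GRing.Theory.
Local Open Scope ring_scope.

(* For Lam of integral type, every a in A_Lam satisfies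
   Delta(a)(1 (x) Lam) = a (x) Lam, whence the key identity
     Lam_1 (x) a Lam_2 = S(a) Lam_1 (x) Lam_2     (a in A_Lam).
   If a functional phi satisfies Lam_1 phi(Lam_2) = c g, pairing it with the
   second leg gives Lam_1 phi(a Lam_2) = c S(a) g.  When phi is faithful and
   A_Lam is finite-dimensional, every functional on A_Lam has the form phi(a -),
   so the left legs of Lam span c S(A_Lam) g, which forces c <> 0 because
   Lam <> 0.  Conversely, g = S(1) g is a left leg of Lam, so
   Lam_1 phi(Lam_2) = g for some phi; the same formula makes phi faithful, hence
   the right legs of Lam exhaust A_Lam, and comparing
   Lam_1 (x) Lam_2 phi(Lam_3) = g (x) g on those legs shows that phi is a
   g-cointegral.  Both numbered claims are obtained by testing against the
   functionals phi(a -); for the second, the left integrals are the multiples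
   of Lam and the right integrals those of the r with phi(r -) = eps, for which
   Lam = phi(Lam) S(r) g. *)

Set Implicit Arguments.
Unset Strict Implicit.
Unset Printing Implicit Defensive.

(** * Functionals, independence and bases in spaces of arbitrary dimension *)

Section LinearAlgebra.
Variables (k : fieldType) (H : lmodType k).

Definition subspace (A : H -> Prop) :=
  A 0 /\ forall (c : k) (x y : H), A x -> A y -> A (c *: x + y).

Definition indep n (x : 'I_n -> H) :=
  forall c : 'I_n -> k, \sum_i c i *: x i = 0 -> forall i, c i = 0.

Definition spans n (x : 'I_n -> H) (A : H -> Prop) :=
  forall a, A a -> exists c : 'I_n -> k, a = \sum_i c i *: x i.

Lemma scalar_pack (f : H -> k) : scalar f -> exists F : {scalar H}, f = F.
Proof.
move=> lf.
by exists (HB.pack_for {scalar H} f (GRing.isLinear.Build k H k^o *%R f lf)).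
Qed.

Lemma linear_pack (U : lmodType k) (f : H -> U) :
  linear f -> exists F : {linear H -> U}, f = F.
Proof.
move=> lf.
by exists (HB.pack_for {linear H -> U} f (GRing.isLinear.Build k H U *:%R f lf)).
Qed.

Lemma subspaceD A x y : subspace A -> A x -> A y -> A (x + y).
Proof. by move=> [_ sA] Ax Ay; rewrite -[x]scale1r; apply: sA. Qed.

Lemma subspaceZ A c x : subspace A -> A x -> A (c *: x).
Proof. by move=> [A0 sA] Ax; rewrite -[_ *: _]addr0; apply: sA. Qed.

Lemma subspaceB A x y : subspace A -> A x -> A y -> A (x - y).
Proof.
by move=> sA Ax Ay; rewrite -scaleN1r; apply: subspaceD => //; apply: subspaceZ.
Qed.

Lemma subspace_sum A (I : finType) (P : pred I) (c : I -> k) (x : I -> H) :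
  subspace A -> (forall i, A (x i)) -> A (\sum_(i | P i) c i *: x i).
Proof.
move=> sA Ax; elim/big_ind: _ => [|y z|i _]; first by case: sA.
- exact: subspaceD.
- exact: subspaceZ.
Qed.

(* H may be infinite-dimensional: f is obtained from a subspace that is maximal,
   by Zorn's lemma, among those containing W but not x; its sum with the line
   of x is all of H. *)
Lemma separating_functional (W : H -> Prop) x :
  subspace W -> ~ W x ->
  exists f : {scalar H}, f x = 1 /\ forall w, W w -> f w = 0.
Proof.
move=> sW Wx.
(* [W] is joined by hand so that the empty chain, whose union is empty, still yields a subspace,
   namely [W]. *)
pose N (M : H -> Prop) y := W y \/ M y.
pose P (M : H -> Prop) := subspace (N M) /\ ~ N M x.
have [F FP Ftot|M [[sM Mx] Mmax]] := @classical_sets.Zorn_bigcup H P.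
  split; last by case=> // -[M /FP[_ Mx] xM]; apply: Mx; right.
  split=> [|c y z]; first by left; case: sW.
  have inM M : F M -> M y \/ W y -> M z \/ W z ->
      N (classical_sets.bigcup F id) (c *: y + z).
    move=> FM yM zM; have [[_ sM] _] := FP _ FM.
    have [|||w] := sM c y z; [by case: yM; [right|left]| |by left|].
      by case: zM; [right|left].
    by right; exists M.
  case=> [yW|[M1 FM1 yM1]] [zW|[M2 FM2 zM2]].
  - by left; case: sW => _; apply.
  - by apply: (inM M2) => //; [right|left].
  - by apply: (inM M1) => //; [left|right].
  - have [s12|s21] := Ftot _ _ FM1 FM2.
    + by apply: (inM M2) => //; left=> //; apply: s12.
    + by apply: (inM M1) => //; left=> //; apply: s21.
(* For [y] outside, maximality forces the sum with the line of [y] to contain [x]; solving for [y]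
   gives the coefficient. *)
have ex_c y : exists c, N M (y - c *: x).
  have [yM|yM] := pselect (N M y); first by exists 0; rewrite scale0r subr0.
  pose M' z := exists c, N M (z - c *: y).
  have sM' : subspace M'.
    split=> [|c u v [a ua] [b vb]].
      by exists 0; rewrite scale0r subr0; case: sM.
    exists (c * a + b); rewrite scalerDl opprD addrACA -scalerA -scalerBr.
    by case: sM => _; apply.
  have MM' z : N M z -> M' z by move=> ?; exists 0; rewrite scale0r subr0.
  have [a xa] : M' x.
    apply: contrapT => nx; apply: (Mmax M').
      split=> [z zM|sub]; first by apply: MM'; right.
      by apply: yM; right; apply: sub; exists 1; rewrite scale1r subrr; case: sM.
    have NE : N M' = M'.
      by apply/funext=> z; apply/propext; split=> [[zW|//]|]; [apply: MM'; left|right].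
    by rewrite /P NE.
  have a0 : a != 0.
    by apply/eqP => a0; apply: Mx; move: xa; rewrite a0 scale0r subr0.
  exists a^-1; have -> : y - a^-1 *: x = - a^-1 *: (x - a *: y).
    by rewrite scalerBr scalerA mulNr mulVf // scaleN1r opprK scaleNr addrC.
  exact: subspaceZ.
have [f fP] := choice ex_c.
have uniq y c d : N M (y - c *: x) -> N M (y - d *: x) -> c = d.
  move=> yc yd; apply/eqP; rewrite -subr_eq0; apply/negPn/negP => cd; apply: Mx.
  have -> : x = (c - d)^-1 *: ((y - d *: x) - (y - c *: x)).
    rewrite opprB [_ + (c *: x - y)]addrC addrA addrNK -scalerBl.
    by rewrite scalerA mulVf ?scale1r.
  by apply: subspaceZ => //; apply: subspaceB.
have lf : scalar f.
  move=> c y z; apply: (uniq (c *: y + z)); first exact: fP.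
  rewrite scalerDl opprD addrACA -scalerA -scalerBr.
  by case: sM => _; apply.
have [F fF] := scalar_pack lf; subst f; exists F; split=> [|w wW].
  by apply: (uniq x) (fP _) _; rewrite scale1r subrr; case: sM.
by apply: (uniq w) (fP _) _; rewrite scale0r subr0; left.
Qed.

(** Each [x i] is separated from the span of the others, coded as the combinations with
    [c i = 0]. *)
Lemma dual_family n (x : 'I_n -> H) : indep x ->
  exists d : 'I_n -> {scalar H}, forall i j, d i (x j) = (i == j)%:R.
Proof.
move=> ix.
suff ex_d i : exists f : {scalar H}, forall j, f (x j) = (i == j)%:R.
  exact: fin_all_exists ex_d.
pose W y := exists c : 'I_n -> k, c i = 0 /\ y = \sum_j c j *: x j.
have sW : subspace W.
  split=> [|c u v [a [ai ->]] [b [bi ->]]].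
    by exists (fun=> 0); split=> //; rewrite big1 // => j _; rewrite scale0r.
  exists (fun j => c * a j + b j); split; first by rewrite ai bi mulr0 addr0.
  rewrite scaler_sumr -big_split /=; apply: eq_bigr => j _.
  by rewrite scalerDl scalerA.
have delta j : x j = \sum_l (l == j)%:R *: x l.
  rewrite (bigD1 j) //= eqxx scale1r big1 ?addr0 // => l /negPf ->.
  by rewrite scale0r.
have nW : ~ W (x i).
  case=> c [ci]; rewrite {1}delta => /eqP; rewrite -subr_eq0 -sumrB => /eqP E.
  have /(_ _ i)/eqP := ix (fun j => (j == i)%:R - c j).
  rewrite eqxx ci subr0 oner_eq0; case/(_ _)/notF.
  by rewrite -[RHS]E; apply: eq_bigr => j _; rewrite scalerBl.
have [f [fi fW]] := separating_functional sW nW; exists f => j.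
have [<-|ij] := eqVneq; first by rewrite fi.
apply: fW; exists (fun l => (l == j)%:R); split; last exact: delta.
by rewrite (negPf ij).
Qed.

(** Separating some [a0] with [phi a0 <> 0] from the kernel of [phi] in [A] gives a functional
    proportional to [phi] on [A]. *)
Lemma functional_extension (A : H -> Prop) (phi : H -> k) : subspace A ->
  (forall c x y, A x -> A y -> phi (c *: x + y) = c * phi x + phi y) ->
  exists f : {scalar H}, forall a, A a -> f a = phi a.
Proof.
move=> sA lphi; have A0 : A 0 by case: sA.
have phi0 : phi 0 = 0.
  have := lphi 1 0 0 A0 A0; rewrite scaler0 addr0 mul1r => /eqP.
  by rewrite -[X in X == _]addr0 (inj_eq (addrI _)) => /eqP.
have [[a0 [Aa0 pa0]]|nA] := pselect (exists a, A a /\ phi a <> 0); last first.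
  have [|F FE] := @scalar_pack (fun=> 0); first by move=> c x y; rewrite mulr0 addr0.
  exists F => a Aa; rewrite -FE; apply: contrapT => pa; apply: nA; exists a.
  by split=> // pa0; apply: pa; rewrite pa0.
pose W a := A a /\ phi a = 0.
have sW : subspace W.
  split=> [//|c x y [Ax px] [Ay py]]; split; last by rewrite lphi // px py mulr0 addr0.
  by case: sA => _; apply.
have nW : ~ W a0 by case.
have [f [f1 fW]] := separating_functional sW nW.
have [|F FE] := @scalar_pack (fun a => phi a0 * f a).
  by move=> c x y /=; rewrite linearP mulrDr mulrCA.
exists F => a Aa; rewrite -FE.
have pa0' : phi a0 != 0 by apply/eqP.
have : W (- (phi a / phi a0) *: a0 + a).
  split; first by case: sA => _; apply.
  by rewrite lphi // mulNr divfK // addNr.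
move/fW; rewrite linearP f1 /= mulr1 => /eqP; rewrite addrC subr_eq0 => /eqP ->.
by rewrite mulrC divfK.
Qed.

(** [a] sits at index 0 and [b] is shifted by one; a nonzero coefficient at 0 would express [a]
    through [b]. *)
Lemma indep_extend n (b : 'I_n -> H) a :
  indep b -> ~ (exists c : 'I_n -> k, a = \sum_i c i *: b i) ->
  indep (fun i : 'I_n.+1 => oapp b a (unlift ord0 i)).
Proof.
move=> ib na c; rewrite big_ord_recl unlift_none /=.
under eq_bigr do rewrite liftK /=.
move=> E; have c0 : c ord0 = 0.
  apply/eqP/negPn/negP => c0; apply: na.
  exists (fun i => - (c ord0)^-1 * c (lift ord0 i)).
  under eq_bigr do rewrite -scalerA.
  rewrite -scaler_sumr; move/eqP: E; rewrite addrC addr_eq0 => /eqP ->.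
  by rewrite scaleNr scalerN opprK scalerA mulVf ?scale1r.
move: E; rewrite c0 scale0r add0r => /ib E i.
by case: (unliftP ord0 i) => [j|] ->.
Qed.

(** Independent families are enlarged one vector at a time until one spans; otherwise length [N.+1]
    contradicts the bound. *)
Lemma finite_basis (A : H -> Prop) N : subspace A ->
  (forall n (b : 'I_n -> H), (forall i, A (b i)) -> indep b -> (n <= N)%N) ->
  exists n (b : 'I_n -> H), [/\ forall i, A (b i), indep b & spans b A].
Proof.
move=> sA bnd.
suff [//|[b [Ab ib]]] :
    (exists n (b : 'I_n -> H), [/\ forall i, A (b i), indep b & spans b A])
    \/ exists b : 'I_N.+1 -> H, (forall i, A (b i)) /\ indep b.
  by have := bnd _ _ Ab ib; rewrite ltnn.
elim: N.+1 => {bnd} [|n [?|[b [Ab ib]]]]; [|by left|].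
  by right; exists (fun=> 0); split=> [i|c _ i]; [case: sA|case: i].
have [sb|nb] := pselect (spans b A); first by left; exists n, b.
right; have [a [Aa na]] : exists a, A a /\ ~ exists c : 'I_n -> k, a = \sum_i c i *: b i.
  apply: contrapT => H0; apply: nb => a Aa; apply: contrapT => na.
  by apply: H0; exists a.
exists (fun i => oapp b a (unlift ord0 i)); split; last exact: indep_extend.
by move=> i; case: unliftP => [j _|_] /=.
Qed.

(** The images of the [b i] are the rows of a matrix of full row rank with [N] columns. *)
Lemma indep_bound (A : H -> Prop) N (T : {linear H -> 'rV[k]_N}) : subspace A ->
  (forall a, A a -> T a = 0 -> a = 0) ->
  forall n (b : 'I_n -> H), (forall i, A (b i)) -> indep b -> (n <= N)%N.
Proof.
move=> sA injT n b Ab ib.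
suff /eqP <- : row_free (\matrix_(i < n) T (b i)) by exact: rank_leq_col.
rewrite -kermx_eq0; apply/eqP/row_matrixP => r; rewrite row0.
set u := row r _.
have : u *m \matrix_(i < n) T (b i) = 0.
  by apply/sub_kermxP; rewrite row_sub.
rewrite mulmx_sum_row; under eq_bigr do rewrite rowK -linearZ.
rewrite -linear_sum => /injT E.
apply/rowP=> i; rewrite [RHS]mxE; apply: (ib (fun i => u 0 i)).
by apply: E; exact: subspace_sum.
Qed.

End LinearAlgebra.

(** * Formal tensors and their values under bilinear maps *)

Section Tensor.
Variables (k : fieldType) (H : algType k).
Implicit Types (V : lmodType k) (t u : seq (H * H)).

Lemma linear_funid : linear (fun x : H => x).
Proof. by []. Qed.

Lemma linear_funmull (b : H) (u : H -> H) : linear u -> linear (fun x => b * u x).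
Proof. by move=> lu c x y /=; rewrite lu mulrDr scalerAr. Qed.

Lemma linear_funmulr (b : H) (u : H -> H) : linear u -> linear (fun x => u x * b).
Proof. by move=> lu c x y /=; rewrite lu mulrDl scalerAl. Qed.

Lemma linear_funcomp V (S : {linear H -> V}) (u : H -> H) :
  linear u -> linear (fun x => S (u x)).
Proof. by move=> lu c x y /=; rewrite lu linearP. Qed.

Lemma linear_funscal V (F : {scalar H}) (u : H -> H) (v : V) :
  linear u -> linear (fun x => F (u x) *: v).
Proof. by move=> lu c x y /=; rewrite lu linearP scalerDl scalerA. Qed.

Lemma linear_funscaler V (c : k) (u : H -> V) :
  linear u -> linear (fun x => c *: u x).
Proof. by move=> lu d x y /=; rewrite lu scalerDr !scalerA mulrC. Qed.

Lemma linear_funtsum V (f : H -> H -> H -> V) t :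
  (forall x y, linear (fun z => f z x y)) -> linear (fun z => tsum (f z) t).
Proof.
move=> lf c x y /=; rewrite /tsum scaler_sumr -big_split /=.
by apply: eq_bigr => p _; rewrite lf.
Qed.

Section Bilinear.
Variables (V : lmodType k) (f : H -> H -> V).
Hypothesis bf : bilin f.

Lemma bilin_linl (b : H) (u : H -> H) : linear u -> linear (fun x => f (u x) b).
Proof. by case: bf => lf _ lu c x y /=; rewrite lu lf. Qed.

Lemma bilin_linr (a : H) (u : H -> H) : linear u -> linear (fun x => f a (u x)).
Proof. by case: bf => _ lf lu c x y /=; rewrite lu lf. Qed.

Lemma bilin_packl b : exists F : {linear H -> V}, f^~ b = F.
Proof. by apply: linear_pack; apply: (@bilin_linl b id). Qed.

Lemma bilin_packr a : exists F : {linear H -> V}, f a = F.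
Proof. by apply: linear_pack; apply: (@bilin_linr a id). Qed.

Lemma bilin_suml I (r : seq I) (P : pred I) (x : I -> H) b :
  f (\sum_(i <- r | P i) x i) b = \sum_(i <- r | P i) f (x i) b.
Proof.
have [F E] := bilin_packl b; rewrite -/((f^~ b) _) E linear_sum.
by apply: eq_bigr => i _; rewrite -E.
Qed.

Lemma bilinZl c x b : f (c *: x) b = c *: f x b.
Proof. by have [F E] := bilin_packl b; rewrite -/((f^~ b) _) E linearZ /= -E. Qed.

Lemma bilinZr c x a : f a (c *: x) = c *: f a x.
Proof. by have [F ->] := bilin_packr a; rewrite linearZ. Qed.

Lemma bilinBr x y a : f a (x - y) = f a x - f a y.
Proof. by have [F ->] := bilin_packr a; rewrite linearB. Qed.

Lemma bilin0r a : f a 0 = 0.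
Proof. by have [F ->] := bilin_packr a; rewrite linear0. Qed.

Lemma bilin0l b : f 0 b = 0.
Proof. by have [F E] := bilin_packl b; rewrite -/((f^~ b) _) E linear0. Qed.

Lemma bilin_swap : bilin (fun x y => f y x).
Proof. by case: bf. Qed.

End Bilinear.

Lemma bilinP V (f : H -> H -> V) : (forall b, linear (fun x => f x b)) ->
  (forall a, linear (fun y => f a y)) -> bilin f.
Proof. by []. Qed.

Lemma trilinP V (f : H -> H -> H -> V) :
  (forall b d, linear (fun x => f x b d)) -> (forall a d, linear (fun y => f a y d)) ->
  (forall a b, linear (fun y => f a b y)) -> trilin f.
Proof. by []. Qed.

Lemma eq_tsum V (f g : H -> H -> V) t : (forall a b, f a b = g a b) ->
  tsum f t = tsum g t.
Proof. by move=> fg; apply: eq_bigr. Qed.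

Lemma tsum_exchange V (f : H -> H -> H -> H -> V) t u :
  tsum (fun a b => tsum (f a b) u) t = tsum (fun c d => tsum (fun a b => f a b c d) t) u.
Proof. exact: exchange_big. Qed.

(** A left leg depending on the others is eliminated, its right leg being distributed over the
    remaining terms. *)
Lemma reduce_family n (x y : 'I_n.+1 -> H) : ~ indep x ->
  exists x' y' : 'I_n -> H, forall V (f : H -> H -> V), bilin f ->
    \sum_i f (x i) (y i) = \sum_i f (x' i) (y' i).
Proof.
move=> nx.
have [c [i [E ci]]] : exists c i, \sum_i c i *: x i = 0 /\ c i != 0.
  apply: contrapT => H0; apply: nx => c E i; apply/eqP/negPn/negP => ci.
  by apply: H0; exists c, i.
exists (fun j => x (lift i j)), (fun j => y (lift i j) - ((c i)^-1 * c (lift i j)) *: y i).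
move=> V f bf; rewrite (bigD1_ord i) //=.
under [RHS]eq_bigr do rewrite (bilinBr bf).
rewrite sumrB [RHS]addrC; congr (_ + _).
have -> : x i = \sum_j - ((c i)^-1 * c (lift i j)) *: x (lift i j).
  under eq_bigr do rewrite scaleNr -scalerA.
  rewrite sumrN -scaler_sumr; move/eqP: E; rewrite (bigD1_ord i) //= addrC addr_eq0 => /eqP ->.
  by rewrite scalerN opprK scalerA mulVf ?scale1r.
rewrite (bilin_suml bf) -sumrN; apply: eq_bigr => j _.
by rewrite (bilinZl bf) (bilinZr bf) scaleNr.
Qed.

(* A representation of minimal length has independent legs on both sides. *)
Lemma tensor_normal_form t : exists n (x y : 'I_n -> H),
  [/\ indep x, indep y & forall V (f : H -> H -> V), bilin f ->
    tsum f t = \sum_i f (x i) (y i)].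
Proof.
have: exists n (x y : 'I_n -> H), forall V (f : H -> H -> V), bilin f ->
    tsum f t = \sum_i f (x i) (y i).
  exists (size t), (fun i => (tnth (in_tuple t) i).1), (fun i => (tnth (in_tuple t) i).2).
  by move=> V f _; rewrite /tsum big_tnth.
case=> n; elim: n => [|n IH] [x [y E]].
  by exists 0, x, y; split=> //; move=> c _ [].
have [ix|nx] := pselect (indep x); last first.
  have [x' [y' E']] := reduce_family y nx.
  by apply: IH; exists x', y' => V f bf; rewrite E // E'.
have [iy|ny] := pselect (indep y); first by exists n.+1, x, y.
have [y' [x' E']] := reduce_family x ny.
apply: IH; exists x', y' => V f bf; rewrite E //.
exact: (E' V (fun a b => f b a) (bilin_swap bf)).
Qed.

(** In a normal form of [t - u] the right legs are independent, so dual functionals extract each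
    left leg, which must vanish. *)
Lemma teq_functional t u :
  (forall nu : {scalar H}, tsum (fun x y => nu y *: x) t = tsum (fun x y => nu y *: x) u) ->
  teq t u.
Proof.
move=> E.
pose w := t ++ tscale (-1) u.
have wE V (f : H -> H -> V) : bilin f -> tsum f w = tsum f t - tsum f u.
  move=> bf; rewrite /tsum big_cat big_map -sumrN; congr (_ + _).
  by apply: eq_bigr => p _; rewrite (bilinZl bf) scaleN1r.
have [n [x [y [_ iy nf]]]] := tensor_normal_form w.
have [d dE] := dual_family iy.
have x0 i : x i = 0.
  have bd : bilin (fun a b : H => d i b *: a).
    apply: bilinP => b; first exact/linear_funscaler/linear_funid.
    exact/linear_funscal/linear_funid.
  have := nf _ _ bd; rewrite wE // E subrr (bigD1 i) //= dE eqxx scale1r.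
  rewrite big1 ?addr0 // => j ij; by rewrite dE eq_sym (negPf ij) scale0r.
move=> V f bf; apply/eqP; rewrite -subr_eq0 -wE // nf //.
by rewrite big1 // => i _; rewrite x0 (bilin0l bf).
Qed.

End Tensor.

(** Proves linearity by peeling off the outermost operation; a variable inside [Delta] is left to
    [Delta_linear]. *)
Ltac lin1 :=
  lazymatch goal with
  | |- bilin _ => apply: bilinP => ? /=
  | |- trilin _ => apply: trilinP => ? ? /=
  | _ => first
    [ exact: linear_funid
    | match goal with hf : bilin ?f |- _ =>
        first [apply: (bilin_linl hf) | apply: (bilin_linr hf)] end
    | apply: linear_funscaler
    | apply: linear_funscal
    | apply: linear_funmull
    | apply: linear_funmulr
    | apply: linear_funtsum => ? ? /=
    | apply: linear_funcomp ]
  end.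
Ltac lin := repeat lin1.

(** * Sweedler calculus in a Hopf algebra *)

Section Hopf.
Variables (k : fieldType) (H : algType k) (Delta : H -> seq (H * H)).
Variables (eps : {scalar H}) (S : {linear H -> H}).
Hypothesis hopfH : is_hopf Delta eps S.

Lemma Delta_linear (V : lmodType k) (f : H -> H -> V) (u : H -> H) : bilin f -> linear u ->
  linear (fun x => tsum f (Delta (u x))).
Proof.
move=> bf lu c x y /=; rewrite lu (Delta_lin hopfH c (u x) (u y) bf) /tsum big_cat big_map.
by rewrite scaler_sumr; congr (_ + _); apply: eq_bigr => p _; rewrite (bilinZl bf).
Qed.

Lemma tsum_Delta_mul (V : lmodType k) (f : H -> H -> V) x y : bilin f ->
  tsum f (Delta (x * y)) =
  tsum (fun a b => tsum (fun c d => f (a * c) (b * d)) (Delta y)) (Delta x).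
Proof. by move=> bf; rewrite (Delta_mul hopfH x y bf) /tsum big_allpairs_dep. Qed.

Lemma tsum_coassoc (V : lmodType k) (f : H -> H -> H -> V) x : trilin f ->
  tsum (fun a d => tsum (fun b c => f b c d) (Delta a)) (Delta x) =
  tsum (fun a d => tsum (fun b c => f a b c) (Delta d)) (Delta x).
Proof. by move=> tf; exact: (Delta_coassoc hopfH tf). Qed.

Lemma tsum_counitl (V : lmodType k) (f : {linear H -> V}) x :
  tsum (fun a b => eps a *: f b) (Delta x) = f x.
Proof.
rewrite -[in RHS](counit_l hopfH x) linear_sum.
by apply: eq_bigr => p _; rewrite linearZ.
Qed.

Lemma tsum_counitr (V : lmodType k) (f : {linear H -> V}) x :
  tsum (fun a b => eps b *: f a) (Delta x) = f x.
Proof.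
rewrite -[in RHS](counit_r hopfH x) linear_sum.
by apply: eq_bigr => p _; rewrite linearZ.
Qed.

Lemma tsum_antipodel (V : lmodType k) (f : {linear H -> V}) x :
  tsum (fun a b => f (S a * b)) (Delta x) = eps x *: f 1.
Proof. by rewrite /tsum -linear_sum (antipode_l hopfH x) linearZ. Qed.

Lemma tsum_antipoder (V : lmodType k) (f : {linear H -> V}) x :
  tsum (fun a b => f (a * S b)) (Delta x) = eps x *: f 1.
Proof. by rewrite /tsum -linear_sum (antipode_r hopfH x) linearZ. Qed.

Lemma antipode1 : S 1 = 1.
Proof.
have bf : bilin (fun a b => S a * b) by lin.
have := Delta_one hopfH bf; rewrite /tsum big_seq1 mulr1 => <-.
by rewrite (antipode_l hopfH) (eps_one hopfH) scale1r.
Qed.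

Lemma grouplike_eps g : grouplike Delta g -> eps g = 1.
Proof.
case=> g0 Dg; have bf : bilin (fun a b => eps a *: b) by lin.
have := Dg _ _ bf; rewrite /tsum big_seq1 (counit_l hopfH) => /eqP /=.
rewrite eq_sym -subr_eq0 -[X in _ - X]scale1r -scalerBl scaler_eq0 subr_eq0.
by case/orP=> /eqP.
Qed.

Lemma grouplike_antipoder g : grouplike Delta g -> g * S g = 1.
Proof.
move=> gg; have bf : bilin (fun a b => a * S b) by lin.
have := gg.2 _ _ bf; rewrite /tsum big_seq1 (antipode_r hopfH) => /= <-.
by rewrite (grouplike_eps gg) scale1r.
Qed.

Lemma mulr_grouplike_inj g : grouplike Delta g -> injective (fun x => x * g).
Proof.
move=> gg x y /= E.
by rewrite -[x]mulr1 -[y]mulr1 -(grouplike_antipoder gg) !mulrA E.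
Qed.

(** * The left coideal subalgebra of an element of integral type *)

Section IntegralType.
Variable Lam : H.
Hypothesis hLam : integral_type Delta Lam.
Let Lam0 : Lam <> 0. Proof. by case: hLam. Qed.

Lemma integral_tsum (V : lmodType k) (f : H -> H -> V) : bilin f ->
  tsum (fun a b => f a (b * Lam)) (Delta Lam) = f Lam Lam.
Proof. by case: hLam => _ E bf; have := E _ _ bf; rewrite /tsum big_map big_seq1. Qed.

Lemma exists_normalized : exists nu : {scalar H}, nu Lam = 1.
Proof.
have s0 : subspace (fun x : H => x = 0).
  by split=> // c x y -> ->; rewrite scaler0 addr0.
by have [f [f1 _]] := separating_functional s0 Lam0; exists f.
Qed.

(** By the hypothesis [b_1 (x) S(b_2) Lam] is [a_1 (x) S(a_2) a_3 Lam], which collapses to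
    [a (x) Lam]. *)
Lemma antipode_transfer a b :
  (forall (V : lmodType k) (f : H -> H -> V), bilin f ->
     tsum (fun x y => f x (y * Lam)) (Delta a) = f b Lam) ->
  forall (V : lmodType k) (f : H -> H -> V), bilin f ->
    f a Lam = tsum (fun x y => f x (S y * Lam)) (Delta b).
Proof.
move=> E V f bf.
have bg : bilin (fun x z => tsum (fun u v => f u (S v * z)) (Delta x)).
  lin; apply: (@Delta_linear _ (fun u v => f u (S v * _)) id); lin.
rewrite -(E _ _ bg) (@tsum_coassoc _ (fun u v y => f u (S v * (y * Lam)))); last by lin.
have [F FE] : exists F : {linear H -> V}, (fun x => f x Lam) = F.
  by apply: linear_pack; lin.
rewrite -/((fun x => f x Lam) a) FE -tsum_counitr; apply: eq_tsum => x z.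
rewrite -FE.
have [G GE] : exists G : {linear H -> V}, (fun y => f x (y * Lam)) = G.
  by apply: linear_pack; lin.
have := tsum_antipodel G z; rewrite -GE mul1r => <-.
by apply: eq_tsum => u v; rewrite mulrA.
Qed.

(* The element b in the definition of A_ is forced to be a: b satisfies the
   same relation with itself, and by antipode_transfer both a (x) Lam and
   b (x) Lam equal b_1 (x) S(b_2) Lam. *)
Lemma A_tsum a (V : lmodType k) (f : H -> H -> V) : A_ Delta Lam a -> bilin f ->
  tsum (fun x y => f x (y * Lam)) (Delta a) = f a Lam.
Proof.
case=> b Eb.
have Ea (U : lmodType k) (h : H -> H -> U) : bilin h ->
    tsum (fun x y => h x (y * Lam)) (Delta a) = h b Lam.
  by move=> bh; have := Eb _ _ bh; rewrite /tsum big_map big_seq1.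
suff ba : b = a by move=> bf; rewrite Ea ?ba.
have [nu nu1] := exists_normalized.
(* As [nu Lam = 1], both sides equal [nu(a_3 Lam) h(a_1, a_2 Lam)]: the left by [Ea], the right by
   [Ea] and the integral identity of [Lam]. *)
have Eb' (U : lmodType k) (h : H -> H -> U) : bilin h ->
    tsum (fun x y => h x (y * Lam)) (Delta b) = h b Lam.
  move=> bh.
  have bD : bilin (fun x z => nu z *: tsum (fun u v => h u (v * Lam)) (Delta x)).
    lin; apply: (@Delta_linear _ (fun u v => h u (v * Lam)) id); lin.
  have := Ea _ _ bD; rewrite nu1 scale1r => <-.
  have := @tsum_coassoc _ (fun u v z => nu (z * Lam) *: h u (v * Lam)) a.
  rewrite (eq_tsum (g := fun x z => nu (z * Lam) *: tsum (fun u v => h u (v * Lam)) (Delta x)));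
    last by move=> x z; rewrite /tsum scaler_sumr.
  move=> ->; last by lin.
  have bE : bilin (fun x y => tsum (fun c d => nu (d * Lam) *: h x c) (Delta y)).
    lin; apply: (@Delta_linear _ (fun c d => nu (d * Lam) *: h _ c) id); lin.
  have I (x : H) : bilin (fun u v => nu v *: h x u) by lin.
  have := Ea _ _ bE.
  rewrite (integral_tsum (I b)) nu1 scale1r => <-.
  apply: eq_tsum => x y; rewrite tsum_Delta_mul; last by lin.
  apply: eq_tsum => c d; have := @integral_tsum _ (fun u v => nu (d * v) *: h x (c * u)).
  by move=> <-; [apply: eq_tsum => u v; rewrite mulrA|lin].
have bs : bilin (fun x y : H => nu y *: x) by lin.
have := antipode_transfer Ea bs; rewrite -(antipode_transfer Eb' bs) nu1 !scale1r.
by move->.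

Qed.

Lemma A_P a : (forall nu : {scalar H},
    tsum (fun x y => nu (y * Lam) *: x) (Delta a) = nu Lam *: a) -> A_ Delta Lam a.
Proof.
move=> E; exists a; apply: teq_functional => nu.
by rewrite /tsum big_map big_seq1 /=; exact: E.
Qed.

Lemma A_Lam : A_ Delta Lam Lam.
Proof. by exists Lam; case: hLam. Qed.

Lemma A_1 : A_ Delta Lam 1.
Proof.
apply: A_P => nu; rewrite (Delta_one hopfH); last by lin.
by rewrite /tsum big_seq1 mul1r.
Qed.

Lemma A_subspace : subspace (A_ Delta Lam).
Proof.
have lD (nu : {scalar H}) :
    linear (fun a => tsum (fun x y => nu (y * Lam) *: x) (Delta a)).
  by apply: (@Delta_linear _ (fun x y => nu (y * Lam) *: x) id); lin.
split=> [|c x y Ax Ay]; apply: A_P => nu.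
  by have [F /(congr1 (fun h => h 0)) /= ->] := linear_pack (lD nu); rewrite linear0 scaler0.
have bf : bilin (fun x y => nu y *: x) by lin.
rewrite lD (A_tsum Ax bf) (A_tsum Ay bf).
by rewrite scalerDr !scalerA mulrC.
Qed.

Lemma A_mul a b : A_ Delta Lam a -> A_ Delta Lam b -> A_ Delta Lam (a * b).
Proof.
move=> Aa Ab; apply: A_P => nu; rewrite tsum_Delta_mul; last by lin.
rewrite (eq_tsum (g := fun x y => nu (y * Lam) *: (x * b))); last first.
  move=> x y; have := @A_tsum b _ (fun u v => nu (y * v) *: (x * u)) Ab.
  by move=> <-; [apply: eq_tsum => u v; rewrite mulrA|lin].
by apply: (@A_tsum a _ (fun x y => nu y *: (x * b))) => //; lin.
Qed.

(** Applies [eps] to the first leg of [a_1 (x) a_2 Lam = a (x) Lam]. *)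
Lemma A_mul_Lam a : A_ Delta Lam a -> a * Lam = eps a *: Lam.
Proof.
move=> Aa; have bf : bilin (fun x y => eps x *: y) by lin.
rewrite -(A_tsum Aa bf) -[in LHS](counit_l hopfH a) mulr_suml.
by apply: eq_bigr => p _; rewrite scalerAl.
Qed.

(** The left coideal property. By coassociativity [a_1 (x) a_2 (x) a_3 Lam = a_1 (x) a_2 (x) Lam],
    and functionals dual to the independent left legs isolate each [y i] in it. *)
Lemma A_coideal a : A_ Delta Lam a -> exists n (x y : 'I_n -> H),
  [/\ indep x, indep y, forall i, A_ Delta Lam (y i) &
    forall (V : lmodType k) (f : H -> H -> V), bilin f ->
    tsum f (Delta a) = \sum_i f (x i) (y i)].
Proof.
move=> Aa; have [n [x [y [ix iy nf]]]] := tensor_normal_form (Delta a).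
exists n, x, y; split=> // i; have [d dE] := dual_family ix.
apply: A_P => nu.
have lD : linear (fun a => tsum (fun x y => nu (y * Lam) *: x) (Delta a)).
  by apply: (@Delta_linear _ (fun x y => nu (y * Lam) *: x) id); lin.
have pick (g : H -> H) : \sum_j d i (x j) *: g (y j) = g (y i).
  rewrite (bigD1 i) //= dE eqxx scale1r big1 ?addr0 // => j ij.
  by rewrite dE eq_sym (negPf ij) scale0r.
rewrite -(pick (fun z => tsum _ (Delta z))) -(pick (fun z => nu Lam *: z)).
rewrite -(nf _ (fun x z => d i x *: tsum _ (Delta z))); last first.
  by apply: bilinP => b; [lin | apply: linear_funscaler].
rewrite -(nf _ (fun x z => d i x *: (nu Lam *: z))); last by lin.
rewrite (eq_tsum (g := fun x z => tsum (fun u v => d i x *: (nu (v * Lam) *: u)) (Delta z)));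
  last by move=> u v; rewrite /tsum scaler_sumr.
rewrite -(@tsum_coassoc _ (fun x u v => d i x *: (nu (v * Lam) *: u))); last by lin.
rewrite (@A_tsum a _ (fun w v => tsum (fun x u => d i x *: (nu v *: u)) (Delta w))) //.
lin; apply: (@Delta_linear _ (fun x u => d i x *: (nu _ *: u)) id); lin.
Qed.

(** Replacing [a (x) Lam] by [a_1 (x) a_2 Lam] turns the right side into
    [S(a_1) a_2 Lam_1 (x) a_3 Lam_2], where [S(a_1) a_2] collapses. *)
Lemma A_antipode a (V : lmodType k) (f : H -> H -> V) : A_ Delta Lam a -> bilin f ->
  tsum (fun x y => f x (a * y)) (Delta Lam) = tsum (fun x y => f (S a * x) y) (Delta Lam).
Proof.
move=> Aa bf.
have bg : bilin (fun x z => tsum (fun u v => f (S x * u) v) (Delta z)).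
  lin; apply: (@Delta_linear _ (fun u v => f (S _ * u) v) id); lin.
rewrite -(A_tsum Aa bg).
rewrite [RHS](eq_tsum (g := fun x y => tsum (fun u v =>
    tsum (fun c d => f (S x * (u * c)) (v * d)) (Delta Lam)) (Delta y))); last first.
  by move=> x y /=; rewrite tsum_Delta_mul; last by lin.
rewrite -(@tsum_coassoc _ (fun x u v => tsum (fun c d => f (S x * (u * c)) (v * d)) (Delta Lam)));
  last by lin.
have bh : bilin (fun x y => tsum (fun c d => eps x *: f c (y * d)) (Delta Lam)) by lin.
transitivity (tsum (fun x y => tsum (fun c d => eps x *: f c (y * d)) (Delta Lam)) (Delta a)).
  rewrite tsum_exchange; apply: eq_tsum => c d.
  have [F FE] : exists F : {linear H -> V}, (fun y => f c (y * d)) = F.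
    by apply: linear_pack; lin.
  by rewrite -/((fun y => f c (y * d)) a) FE -tsum_counitl -FE.
apply: eq_tsum => x y; rewrite [RHS]tsum_exchange; apply: eq_tsum => c d.
have [F FE] : exists F : {linear H -> V}, (fun x => f (x * c) (y * d)) = F.
  by apply: linear_pack; lin.
have := tsum_antipodel F x; rewrite -FE mul1r => <-.
by apply: eq_tsum => u v; rewrite mulrA.
Qed.

Lemma antipode_eq0 a : S a = 0 -> a = 0.
Proof.
by move=> Sa; apply: (bij_inj (S_bij hopfH)); rewrite Sa linear0.
Qed.

(* Apply s Lam_1 S(Lam_2) (x) Lam_3 = s (x) Lam. *)
Lemma Delta_Lam_cancel s :
  (forall f : H -> H -> H, bilin f ->
     tsum (fun x y => f (s * x) y) (Delta Lam) = 0) -> s = 0.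
Proof.
move=> E; have [nu nu1] := exists_normalized.
have bG : bilin (fun x z => tsum (fun u v => nu v *: (x * S u)) (Delta z)).
  lin; apply: (@Delta_linear _ (fun u v => nu v *: (_ * S u)) id); lin.
have := E _ bG.
rewrite -(@tsum_coassoc _ (fun x u v => nu v *: (s * x * S u))); last by lin.
have [F FE] : exists F : {linear H -> H}, (fun x => s * x) = F.
  by apply: linear_pack; lin.
rewrite (eq_tsum (g := fun x y => eps x *: (nu y *: s))); last first.
  move=> x y; have := tsum_antipoder F x; rewrite -FE mulr1 scalerA mulrC -scalerA => <-.
  by rewrite /tsum scaler_sumr; apply: eq_bigr => p _; rewrite mulrA.
have [K KE] : exists K : {linear H -> H}, (fun y => nu y *: s) = K.
  by apply: linear_pack; lin.
by have := tsum_counitl K Lam; rewrite -KE nu1 scale1r => ->.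
Qed.

(* A_Lam is finite-dimensional because a is determined by the matrix of left
   multiplication by S(a) on the left legs of Lam. *)
Lemma A_basis : exists n (b : 'I_n -> H),
  [/\ forall i, A_ Delta Lam (b i), indep b & spans b (A_ Delta Lam)].
Proof.
have [n [x [y [ix _ nf]]]] := tensor_normal_form (Delta Lam).
have [d dE] := dual_family ix.
have [|T TE] := @linear_pack _ _ _ (fun a => mxvec (\matrix_(i < n, j < n) d i (S a * x j))).
  move=> c a b; rewrite -linearP; congr mxvec; apply/matrixP => i j; rewrite !mxE.
  by rewrite linearP mulrDl -scalerAl linearP.
apply: (@finite_basis _ _ _ (n * n) A_subspace) => m b.
apply: (@indep_bound _ _ _ _ T A_subspace) => a Aa.
rewrite -TE => /(canRL mxvecK); rewrite linear0 => /matrixP M0.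
(* Applying [d i] to the first leg of [A_antipode] writes [a * y i] as a combination of the [y j]
   with coefficients from the zero matrix. *)
have ay i : a * y i = 0.
  have bd : bilin (fun u v => d i u *: v) by lin.
  have := A_antipode Aa bd; rewrite !nf; [|by lin|by lin].
  rewrite (bigD1 i) //= dE eqxx scale1r big1 => [|j ij]; last first.
    by rewrite dE eq_sym (negPf ij) scale0r.
  rewrite addr0 => ->; apply: big1 => j _.
  by have := M0 i j; rewrite !mxE => ->; rewrite scale0r.
apply/antipode_eq0/Delta_Lam_cancel => f bf.
rewrite -(A_antipode Aa bf) nf; last by lin.
by apply: big1 => i _; rewrite ay (bilin0r bf).
Qed.

(** By faithfulness the Gram matrix of [phi] on a basis has trivial left kernel, so its inverse
    supplies the coordinates of [a]. *)
Lemma faithful_represent (phi : {scalar H}) : faithful_on (A_ Delta Lam) phi ->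
  forall nu : {scalar H}, exists a,
    A_ Delta Lam a /\ forall b, A_ Delta Lam b -> phi (a * b) = nu b.
Proof.
move=> fphi nu; have [n [b [Ab ib sb]]] := A_basis.
pose G := \matrix_(i < n, j < n) phi (b i * b j).
have phiE (u : 'rV[k]_n) j : phi ((\sum_i u 0 i *: b i) * b j) = (u *m G) 0 j.
  rewrite mulr_suml linear_sum mxE; apply: eq_bigr => i _.
  by rewrite -scalerAl linearZ mxE.
have AS (u : 'rV[k]_n) : A_ Delta Lam (\sum_i u 0 i *: b i).
  exact: subspace_sum A_subspace Ab.
have phi_ext a (mu : {scalar H}) : (forall j, phi (a * b j) = mu (b j)) ->
    forall z, A_ Delta Lam z -> phi (a * z) = mu z.
  move=> E z /sb[c ->]; rewrite mulr_sumr !linear_sum; apply: eq_bigr => j _.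
  by rewrite -scalerAr !linearZ /= E.
have [|zero zeroE] := @scalar_pack _ H (fun=> 0 : k).
  by move=> c x y; rewrite mulr0 addr0.
have uG : G \in unitmx.
  rewrite -row_free_unit -kermx_eq0; apply/eqP/row_matrixP => r; rewrite row0.
  set u := row r _; have uG0 : u *m G = 0 by apply/sub_kermxP; rewrite row_sub.
  have E : \sum_i u 0 i *: b i = 0.
    apply: fphi => // z Az; rewrite (phi_ext _ zero) -?zeroE // => j.
    by rewrite phiE uG0 mxE.
  by apply/rowP => i; rewrite [RHS]mxE; apply: (ib (fun i => u 0 i)).
pose v := (\row_j nu (b j)) *m invmx G.
exists (\sum_i v 0 i *: b i); split=> //; apply: phi_ext => j.
by rewrite phiE mulmxKV // mxE.
Qed.

(** Nondegeneracy on the other side: a functional equal to 1 at a nonzero [x] has the form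
    [phi (a * _)] on [A_Lam]. *)
Lemma faithful_right (phi : {scalar H}) : faithful_on (A_ Delta Lam) phi ->
  forall x, A_ Delta Lam x -> (forall a, A_ Delta Lam a -> phi (a * x) = 0) -> x = 0.
Proof.
move=> fphi x Ax E; apply: contrapT => x0.
have s0 : subspace (fun x : H => x = 0).
  by split=> // c y z -> ->; rewrite scaler0 addr0.
have [nu [nu1 _]] := separating_functional s0 x0.
have [a [Aa aE]] := faithful_represent fphi nu.
by have /eqP := E a Aa; rewrite aE // nu1 oner_eq0.
Qed.

Lemma A_eq_tsum a (V : lmodType k) (f h : H -> H -> V) : A_ Delta Lam a ->
  bilin f -> bilin h -> (forall x y, A_ Delta Lam y -> f x y = h x y) ->
  tsum f (Delta a) = tsum h (Delta a).
Proof.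
move=> Aa bf bh E; have [n [x [y [_ _ Ay nf]]]] := A_coideal Aa.
by rewrite !nf //; apply: eq_bigr => i _; apply: E.
Qed.

(** Values of [phi] outside [A_Lam] are arbitrary, so [phi] is replaced by a functional on [H]; the
    cointegral identity is read at [Lam], on a representative with second legs in [A_Lam]. *)
Lemma cointegral_extension g phi :
  cointegral Delta (A_ Delta Lam) g phi -> faithful_on (A_ Delta Lam) phi ->
  exists psi : {scalar H}, faithful_on (A_ Delta Lam) psi /\
    tsum (fun x y => psi y *: x) (Delta Lam) = psi Lam *: g.
Proof.
move=> [lphi cphi] fphi.
have [psi psiE] := functional_extension A_subspace lphi.
exists psi; split.
  move=> a Aa E; apply: fphi => // b Ab.
  by rewrite -psiE ?E //; apply: A_mul.
have [n [x [y [_ _ Ay nf]]]] := A_coideal A_Lam.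
have := cphi _ A_Lam [seq (x i, y i) | i <- enum 'I_n].
rewrite big_map big_enum psiE => [E|]; last exact: A_Lam.
rewrite -E => [|V f bf|p /mapP[i _ ->]].
- by rewrite nf; [apply: eq_bigr => i _ /=; rewrite psiE|lin].
- by rewrite nf // /tsum big_map big_enum.
- exact: Ay.
Qed.

(** * Functionals with [Lam_1 phi(Lam_2) = c g] *)

Section Cointegral.
Variables (g : H) (phi : {scalar H}) (c : k).
Hypothesis gg : grouplike Delta g.
Hypothesis phi_Lam : tsum (fun x y => phi y *: x) (Delta Lam) = c *: g.

(** Applies [eps] to [phi_Lam], with [eps g = 1]. *)
Lemma phi_Lam_scale : c = phi Lam.
Proof.
have := congr1 eps phi_Lam; rewrite linearZ /= (grouplike_eps gg) mulr1 => <-.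
rewrite -[in RHS](counit_l hopfH Lam) /tsum !linear_sum; apply: eq_bigr => p _.
by rewrite !linearZ /= mulrC.
Qed.

Lemma cointegral_antipode a : A_ Delta Lam a ->
  tsum (fun x y => phi (a * y) *: x) (Delta Lam) = c *: (S a * g).
Proof.
move=> Aa; rewrite (@A_antipode a _ (fun x y => phi y *: x)) //; last by lin.
rewrite scalerAr -phi_Lam mulr_sumr; apply: eq_bigr => p _.
by rewrite scalerAr.
Qed.

Lemma represent_legs a (nu : {scalar H}) : A_ Delta Lam a ->
  (forall b, A_ Delta Lam b -> phi (a * b) = nu b) ->
  tsum (fun x y => nu y *: x) (Delta Lam) = c *: (S a * g).
Proof.
move=> Aa aE; rewrite -cointegral_antipode //.
apply: A_eq_tsum A_Lam _ _ _; [by lin|by lin|].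
by move=> x y Ay; rewrite aE.
Qed.

(** If [c] were 0, every functional would kill the second leg, so [Delta Lam] and hence [Lam] would
    vanish. *)
Lemma faithful_scale_neq0 : faithful_on (A_ Delta Lam) phi -> c != 0.
Proof.
move=> fphi; apply/eqP => c0; apply: Lam0.
have E : teq (Delta Lam) [::].
  apply: teq_functional => nu; have [a [Aa aE]] := faithful_represent fphi nu.
  by rewrite (represent_legs Aa aE) c0 scale0r /tsum big_nil.
have bf : bilin (fun x y => eps x *: y) by lin.
by have := E _ _ bf; rewrite /tsum (counit_l hopfH) big_nil.
Qed.

(** [represent_legs] gives one inclusion and [cointegral_antipode] the other; [c] is absorbed into
    [a] or into the functional. *)
Lemma faithful_V : faithful_on (A_ Delta Lam) phi ->
  forall x, V_ Delta Lam x <-> exists a, A_ Delta Lam a /\ x = S a * g.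
Proof.
move=> fphi x; have c0 := faithful_scale_neq0 fphi; split.
  case=> nu [lnu ->]; have [F nuF] := scalar_pack lnu; subst nu.
  have [a [Aa aE]] := faithful_represent fphi F.
  exists (c *: a); split; first exact: subspaceZ A_subspace Aa.
  by rewrite linearZ -scalerAl -(represent_legs Aa aE).
case=> a [Aa ->]; exists (fun y => c^-1 * phi (a * y)); split.
  by move=> d y z; rewrite mulrDr -scalerAr linearP mulrDr mulrCA.
have := cointegral_antipode Aa; rewrite /tsum.
move/(congr1 (fun z => c^-1 *: z)); rewrite scalerA mulVf // scale1r => <-.
by rewrite scaler_sumr; apply: eq_bigr => p _; rewrite scalerA.
Qed.

(** If [phi (a * _)] vanishes on [A_Lam], then [c *: (S a * g) = 0], where [c], [g] and [S] can be
    cancelled. *)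
Lemma normalized_faithful : c != 0 -> faithful_on (A_ Delta Lam) phi.
Proof.
move=> c0 a Aa E; apply: antipode_eq0; apply: (mulr_grouplike_inj gg); rewrite mul0r.
apply: (scalerI c0); rewrite scaler0 -cointegral_antipode //.
rewrite (@A_eq_tsum Lam _ _ (fun x y => 0 *: x) A_Lam); [|by lin| |].
- by rewrite /tsum big1 // => p _; rewrite scale0r.
- by apply: bilinP => b d y z; rewrite !scale0r ?scaler0 ?addr0.
- by move=> x y Ay; rewrite E.
Qed.

Lemma normalized_cointegral : c = 1 -> cointegral Delta (A_ Delta Lam) g phi.
Proof.
move=> c1; split=> [d x y _ _|a Aa t tE _]; first exact: linearP.
have bF : bilin (fun u v => phi v *: u) by lin.
have -> : \sum_(p <- t) phi p.2 *: p.1 = tsum (fun u v => phi v *: u) (Delta a).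
  exact: tE bF.
have fphi : faithful_on (A_ Delta Lam) phi.
  by apply: normalized_faithful; rewrite c1 oner_eq0.
have [n [x [y [ix _ Ay nf]]]] := A_coideal A_Lam.
pose W z := exists b : 'I_n -> k, z = \sum_j b j *: y j.
have sW : subspace W.
  split=> [|e u v [b1 ->] [b2 ->]].
    by exists (fun=> 0); rewrite big1 // => j _; rewrite scale0r.
  exists (fun j => e * b1 j + b2 j).
  rewrite scaler_sumr -big_split /=; apply: eq_bigr => j _.
  by rewrite scalerDl scalerA.
(* A functional equal to 1 at [a] and 0 on all [y j] would be [phi (a' * _)] on [A_Lam]; then
   [S a' * g = 0] and [a' = 0], a contradiction. *)
have [b ->] : W a.
  apply: contrapT => nW; have [nu [nu1 nuW]] := separating_functional sW nW.
  have [a' [Aa' aE]] := faithful_represent fphi nu.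
  have : c *: (S a' * g) = 0.
    rewrite -(represent_legs Aa' aE) nf; last by lin.
    apply: big1 => j _; rewrite nuW ?scale0r //.
    exists (fun i => (i == j)%:R); rewrite (bigD1 j) //= eqxx scale1r big1 ?addr0 //.
    by move=> i /negPf ->; rewrite scale0r.
  rewrite c1 scale1r -[RHS](mul0r g) => /(mulr_grouplike_inj gg)/antipode_eq0 a0.
  by have /eqP := aE _ Aa; rewrite a0 mul0r linear0 nu1 eq_sym oner_eq0.
have [d dE] := dual_family ix.
have pick i (h : H -> H) : \sum_j d i (x j) *: h (y j) = h (y i).
  rewrite (bigD1 i) //= dE eqxx scale1r big1 ?addr0 // => j ij.
  by rewrite dE eq_sym (negPf ij) scale0r.
have lD : linear (fun z => tsum (fun u v => phi v *: u) (Delta z)).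
  exact: (@Delta_linear _ _ id).
(* Applies [d i] to the first leg of [Lam_1 (x) Lam_2 phi(Lam_3) = g (x) g]; since [g] is the sum of
   the [phi (y j) *: x j], [d i g = phi (y i)]. *)
have Ey i : tsum (fun u v => phi v *: u) (Delta (y i)) = phi (y i) *: g.
  rewrite -(pick i (fun z => tsum _ (Delta z))) -(pick i (fun z => phi z *: g)).
  rewrite -(nf _ (fun x z => d i x *: tsum _ (Delta z))); last first.
    by apply: bilinP => e; [lin | apply: linear_funscaler].
  rewrite (eq_tsum (g := fun x z => tsum (fun u v => d i x *: (phi v *: u)) (Delta z)));
    last by move=> u v /=; rewrite /tsum scaler_sumr.
  rewrite -(@tsum_coassoc _ (fun x u v => d i x *: (phi v *: u))); last by lin.
  have [K KE] : exists K : {linear H -> H}, (fun w => tsum (fun x u => d i x *: u) (Delta w)) = K.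
    by apply: linear_pack; apply: (@Delta_linear _ (fun x u => d i x *: u) id); lin.
  transitivity (K (tsum (fun u v => phi v *: u) (Delta Lam))).
    rewrite [in RHS]/tsum linear_sum; apply: eq_bigr => p _.
    rewrite linearZ /= -KE /tsum scaler_sumr; apply: eq_bigr => q _.
    by rewrite !scalerA mulrC.
  rewrite phi_Lam c1 scale1r -KE gg.2; last by lin.
  rewrite /tsum big_seq1 /=.
  under eq_bigr do rewrite scalerA.
  rewrite -scaler_suml; congr (_ *: _).
  have := phi_Lam; rewrite nf // c1 scale1r => <-; rewrite linear_sum.
  by apply: eq_bigr => j _; rewrite linearZ mulrC.
have [K KE] := linear_pack lD.
rewrite -[LHS]/((fun z => tsum (fun u v => phi v *: u) (Delta z)) _) KE !linear_sum.
rewrite scaler_suml; apply: eq_bigr => j _.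
by rewrite !linearZ /= -KE Ey scalerA.
Qed.

(** Testing with [nu = phi (a * _)] gives [c *: (S (a * Lam) * g)]; then [a * Lam = eps a *: Lam]
    and [nu Lam = eps a * c] match the sides. *)
Lemma faithful_mul_Lam : faithful_on (A_ Delta Lam) phi ->
  teq [seq (p.1, Lam * p.2) | p <- Delta Lam] [:: (S Lam * g, Lam)].
Proof.
move=> fphi; apply: teq_functional => nu.
rewrite /tsum big_map big_seq1 /=.
have [a [Aa aE]] := faithful_represent fphi nu.
transitivity (tsum (fun x y => phi (a * Lam * y) *: x) (Delta Lam)).
  apply: (@A_eq_tsum Lam _ (fun x y => nu (Lam * y) *: x) _ A_Lam); [by lin|by lin|].
  by move=> x y Ay; rewrite -mulrA aE //; apply: A_mul => //; exact: A_Lam.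
rewrite cointegral_antipode; last by apply: A_mul => //; exact: A_Lam.
rewrite A_mul_Lam // linearZ -scalerAl scalerA; congr (_ *: _).
rewrite -aE ?A_mul_Lam //; last exact: A_Lam.
rewrite linearZ /= mulrC; congr (_ * _).
exact: phi_Lam_scale.
Qed.

(** Both conditions amount to [Lam = c *: r]: the left and right integrals are the lines of [Lam]
    and of [r], and [Lam = c *: (S r * g)]. *)
Lemma integrals_coincide : faithful_on (A_ Delta Lam) phi ->
  (forall x, Leps eps (A_ Delta Lam) x <-> Reps eps (A_ Delta Lam) x) <->
  Lam = S Lam * g.
Proof.
move=> fphi; have c0 := faithful_scale_neq0 fphi; have cE := phi_Lam_scale.
have [r [Ar rE]] := faithful_represent fphi eps.
have LamE : Lam = c *: (S r * g).
  by rewrite -(represent_legs Ar rE) /tsum (counit_r hopfH).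
have AZ z a : A_ Delta Lam a -> A_ Delta Lam (z *: a).
  by move=> Aa; apply: subspaceZ A_subspace Aa.
have Runiq x : Reps eps (A_ Delta Lam) x -> x = phi x *: r.
  case=> Ax xE; apply/eqP; rewrite -subr_eq0; apply/eqP; apply: fphi.
    by apply: subspaceB A_subspace _ _ => //; apply: AZ.
  move=> b Ab; rewrite mulrBl xE // -scalerAl linearB !linearZ /= rE //.
  by rewrite mulrC subrr.
have Luniq x : Leps eps (A_ Delta Lam) x -> x = (phi x / c) *: Lam.
  case=> Ax xE; apply/eqP; rewrite -subr_eq0; apply/eqP.
  apply: (faithful_right fphi).
    by apply: subspaceB A_subspace _ _ => //; apply: AZ; exact: A_Lam.
  move=> a Aa; rewrite mulrBr xE // -scalerAr A_mul_Lam // linearB !linearZ /=.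
  by rewrite -cE mulrCA divfK // subrr.
(* By faithfulness, as [phi (r * a * b)] is [eps (a * b)], that is [eps a * phi (r * b)]. *)
have rR a : A_ Delta Lam a -> r * a = eps a *: r.
  move=> Aa; apply/eqP; rewrite -subr_eq0; apply/eqP; apply: fphi.
    by apply: subspaceB A_subspace _ _; [apply: A_mul|apply: AZ].
  move=> b Ab; rewrite mulrBl -mulrA -scalerAl linearB linearZ /= !rE //; last exact: A_mul.
  by rewrite (eps_mul hopfH) subrr.
have LamL : Leps eps (A_ Delta Lam) Lam by split; [exact: A_Lam|exact: A_mul_Lam].
split=> [LR|E].
  have /LR/Runiq := LamL; rewrite -cE => LE.
  by rewrite [in S _]LE linearZ -scalerAl.
(* [S Lam * g] and [S (c *: r) * g] both equal [Lam]; [g] and [S] cancel. *)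
have LE : Lam = c *: r.
  have /(mulr_grouplike_inj gg)/(bij_inj (S_bij hopfH)) : S Lam * g = S (c *: r) * g => //.
  by rewrite -E linearZ -scalerAl.
have LamR : Reps eps (A_ Delta Lam) Lam.
  split=> [|a Aa]; first exact: A_Lam.
  by rewrite {1 2}LE -scalerAl rR // !scalerA mulrC.
move=> x; split=> [/Luniq ->|/Runiq ->].
  split=> [|a Aa]; first by apply: AZ; exact: A_Lam.
  by rewrite -scalerAl LamR.2 // !scalerA mulrC.
have -> : r = c^-1 *: Lam by rewrite LE scalerA mulVf ?scale1r.
rewrite scalerA; split=> [|a Aa]; first by apply: AZ; exact: A_Lam.
by rewrite -scalerAr A_mul_Lam // !scalerA mulrC.
Qed.

End Cointegral.

End IntegralType.

End Hopf.

Theorem mainTheorem16 (k : fieldType) (H : algType k)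
  (Delta : H -> seq (H * H)) (eps : H -> k) (S : H -> H)
  (hopfH : is_hopf Delta eps S) (Lam g : H)
  (hLam : integral_type Delta Lam) (hg : grouplike Delta g) :
  ((exists phi : H -> k,
      cointegral Delta (A_ Delta Lam) g phi /\ faithful_on (A_ Delta Lam) phi)
   <-> (forall x : H, V_ Delta Lam x <-> exists a : H, A_ Delta Lam a /\ x = S a * g))
  /\
  ((exists phi : H -> k,
      cointegral Delta (A_ Delta Lam) g phi /\ faithful_on (A_ Delta Lam) phi /\
      nonzero_on (A_ Delta Lam) phi) ->
   teq [seq (p.1, Lam * p.2) | p <- Delta Lam] [:: (S Lam * g, Lam)] /\
   ((forall x : H, Leps eps (A_ Delta Lam) x <-> Reps eps (A_ Delta Lam) x)
    <-> Lam = S Lam * g)).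
Proof.
have [e eE] := scalar_pack (eps_lin hopfH); subst eps.
have [s sE] := linear_pack (S_lin hopfH); subst S.
split; [split|].
- case=> phi [cphi fphi].
  have [psi [fpsi psiE]] := cointegral_extension hopfH hLam cphi fphi.
  exact: (faithful_V hopfH hLam psiE fpsi).
(* The witness [1] makes [g] a left leg of [Lam], and the resulting functional has [c = 1]. *)
- move=> E; have [|phi0 [lphi gE]] := (E g).2.
    by exists 1; rewrite (antipode1 hopfH) mul1r; split=> //; exact: (A_1 hopfH Lam).
  have [phi phiE] := scalar_pack lphi; subst phi0.
  have phiE : tsum (fun x y => phi y *: x) (Delta Lam) = 1 *: g.
    by rewrite scale1r [RHS]gE.
  exists phi; split; first exact: (normalized_cointegral hopfH hLam hg phiE (erefl _)).
  exact: (normalized_faithful hopfH hLam hg phiE (oner_neq0 _)).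
- case=> phi [cphi [fphi _]].
  have [psi [fpsi psiE]] := cointegral_extension hopfH hLam cphi fphi.
  split; first exact: (faithful_mul_Lam hopfH hLam hg psiE fpsi).
  exact: (integrals_coincide hopfH hLam hg psiE fpsi).
Qed.
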